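(* For the model of social network with a robot of strength $\alpha$, if $\alpha>N-1$, then the following holds. 1. There exists a constant $\hat{C}=\hat{C}(N)>0$ such that for any $\beta\geq 0$ the invariant probability measure $\nu^{\beta,\alpha}$ of the system satisfies $$\nu^{\beta,\alpha}(\hat{\mathcal{L}}^{+,\alpha})\geq 1-\hat{C}e^{-\beta}.$$ 2. For any fixed $\delta>0$, $$\sup_{u\in\hat{\mathcal{S}}}\mathbb{P}\Big(\hat{R}^{\beta,u}(\hat{\mathcal{L}}^{+,\alpha})>e^{-\beta\alpha(1-\delta)}\Big)\to 0\quad\text{as }\beta\to+\infty.$$
   Context: Let $N\geq 3$, $\mathcal{A}=\{1,\dots,N\}$ (actors), $\mathcal{O}=\{-1,+1\}$ (opinions), let $\beta\geq 0$ be the polarization coefficient and $\alpha>0$ the strength of the robot. The state space is $\hat{\mathcal{S}}=\mathbb{Z}^N$, with elements $u=(u(a):a\in\mathcal{A})$. For $a\in\mathcal{A}$, $\mathfrak{o}\in\mathcal{O}$, define $\pi^{a,\mathfrak{o}}(u)(b)=u(b)+\mathfrak{o}$ if $b\neq a$, and $\pi^{a,\mathfrak{o}}(u)(a)=0$. Define also $\pi^{*,+1}(u)(b)=u(b)+1$ for all $b\in\mathcal{A}$. For $u\in\hat{\mathcal{S}}$, $(\hat{U}_t^{\beta,u})_{t\in[0,+\infty)}$ is the Markov jump process on $\hat{\mathcal{S}}$ started at $u$ with infinitesimal generator $$\hat{\mathcal{G}}f(v)=\sum_{\mathfrak{o}\in\mathcal{O}}\sum_{b\in\mathcal{A}}\exp(\beta\mathfrak{o}v(b))\,[f(\pi^{b,\mathfrak{o}}(v))-f(v)]+\exp(\beta\alpha)\,[f(\pi^{*,+1}(v))-f(v)]$$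 for bounded $f:\hat{\mathcal{S}}\to\mathbb{R}$. This process exists for all times and has a unique invariant probability measure, denoted $\nu^{\beta,\alpha}$. For $\alpha\geq N-1$, $$\hat{\mathcal{L}}^{+,\alpha}=\{u\in\hat{\mathcal{S}}:\ u(a)\neq u(b)\text{ for all }a\neq b\text{ in }\mathcal{A},\ \text{and }0\leq u(a)\leq\lfloor\alpha\rfloor+1\text{ for all }a\in\mathcal{A}\}.$$ Hitting times: for $u\in\hat{\mathcal{S}}$, $B\subset\hat{\mathcal{S}}$, $\hat{R}^{\beta,u}(B)=\inf\{t>0:\hat{U}_t^{\beta,u}\in B\}$. *)

(* Defs.v *)
From HB Require Import structures.
From mathcomp Require Import all_boot all_order all_algebra.
From mathcomp Require Import all_classical all_reals all_analysis.

Set Implicit Arguments.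
Unset Strict Implicit.
Unset Printing Implicit Defensive.

Import Order.TTheory GRing.Theory Num.Theory.
Import numFieldNormedType.Exports.

Local Open Scope classical_set_scope.
Local Open Scope ring_scope.

Section MarkovJumpProcess.
Context {d d' : measure_display} {Omega : measurableType d}
  {S : measurableType d'} {R : realType}.
Variable P : probability Omega R.

(* [U u t w] is the position at time [t >= 0] of the process started at [u];
   its values at negative times are irrelevant. *)
Variable U : S -> R -> Omega -> S.

Definition history (u : S) (s : R) : set (set Omega) :=
  <<s [set A | exists r B,
         [/\ 0 <= r <= s, measurable B & A = U u r @^-1` B]] >>.

Definition semigroup (t : R) (f : S -> R) (u : S) : R :=
  \int[P]_(w in setT) f (U u t w).

(* [S] is understood as a discrete space.  [mjp_right] and [mjp_left] say that
   the paths are right-continuous with left limits for the discrete topology: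
   they are step functions with finitely many jumps on every bounded time
   interval, so the process does not explode. *)
Record markov_jump_process (G : (S -> R) -> S -> R) : Prop := {
  mjp_measurable : forall u t, 0 <= t -> measurable_fun setT (U u t) ;
  mjp_start : forall u w, U u 0 w = u ;
  mjp_right : forall u w t, 0 <= t ->
    \forall s \near t^'+, U u s w = U u t w ;
  mjp_left : forall u w t, 0 < t ->
    exists x, \forall s \near t^'-, U u s w = x ;
  mjp_markov : forall u s t A B, 0 <= s -> 0 <= t ->
    history u s A -> measurable B ->
    P (A `&` U u (s + t) @^-1` B) =
    (\int[P]_(w in A) P (U (U u s w) t @^-1` B))%E ;
  mjp_generator : forall (f : S -> R) v, bounded_fun f ->
    h^-1 * (semigroup h f v - f v) @[h --> 0^'+] --> G f v
}.

Definition invariant_measure (nu : probability S R) : Prop :=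
  forall t B, 0 <= t -> measurable B ->
    (\int[nu]_(u in setT) P (U u t @^-1` B))%E = nu B.

Definition hitting_time (u : S) (B : set S) (w : Omega) : \bar R :=
  ereal_inf [set t%:E | t in [set t : R | 0 < t /\ B (U u t w)]].

End MarkovJumpProcess.

(* The actors are the elements of ['I_N]; the two opinions are the integers
   [-1] and [1]. *)
Definition state (N : nat) : Type := {ffun 'I_N -> int}.

HB.instance Definition _ (N : nat) := Countable.on (state N).
HB.instance Definition _ (N : nat) := isPointed.Build (state N) [ffun=> 0].
HB.instance Definition _ (N : nat) :=
  @isMeasurable.Build default_measure_display (state N)
    discrete_measurable discrete_measurable0
    discrete_measurableC discrete_measurableU.

Section Network.
Context {R : realType} {N : nat}.

Definition express (a : 'I_N) (o : int) (u : state N) : state N :=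
  [ffun b => if b == a then 0 else u b + o].

Definition robot_express (u : state N) : state N := [ffun b => u b + 1].

Definition generator (beta alpha : R) (f : state N -> R) (v : state N) : R :=
  \sum_(o <- [:: -1; 1 : int]) \sum_(b < N)
    expR (beta * o%:~R * (v b)%:~R) * (f (express b o v) - f v)
  + expR (beta * alpha) * (f (robot_express v) - f v).

Definition ladder (alpha : R) : set (state N) :=
  [set u | (forall a b, a != b -> u a != u b) /\
           (forall a, 0 <= u a <= Num.floor alpha + 1)].

End Network.

(* Main.v *)
Require Import Defs.
From mathcomp Require Import all_boot all_order all_algebra.
From mathcomp Require Import all_classical all_reals all_analysis.
From mathcomp Require Import measurable_realfun giry zify lra.

Set Implicit Arguments.
Unset Strict Implicit.
Unset Printing Implicit Defensive.

Import Order.TTheory GRing.Theory Num.Theory.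
Import numFieldNormedType.Exports.

Local Open Scope classical_set_scope.
Local Open Scope ring_scope.
(** Write [top] for [Num.floor alpha + 1].  Both parts follow from a single
    bounded function, [lyapunov], with two properties: it lies between [0] and
    [expR (- (beta * alpha))] times a polynomial in [alpha]
    ([lyapunov_bounds]), and for [1 <= beta] its drift, that is, the generator
    applied to it, is at most [drift_constant R N * expR (- beta)], with an
    additional [- 1] off the ladder ([lyapunov_drift]).  Up to a small error it
    bounds the expected time to the ladder from above.

    Under an invariant measure the mean drift of a bounded function is
    nonnegative, so the mass of the complement of the ladder is at most
    [drift_constant R N * expR (- beta)] ([invariant_mass_ge]); for [beta < 1]
    the first part is trivial because the constant is at least [expR 1].  For
    the second part, let [p] be the probability that the ladder is not hit
    before time [t].  At each time before [t] the process is off the ladder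
    with probability at least [p], so the mean of [lyapunov] decreases at speed
    [p - drift_constant R N * expR (- beta)] at least, while it cannot become
    negative; hence [p] is at most [lyapunov u / t] plus
    [drift_constant R N * expR (- beta)] ([hitting_time_tail]).  With
    [t = expR (- (beta * alpha * (1 - delta)))] this tends to [0] uniformly in
    the starting state.

    A state is off the ladder for one of three reasons, each with its own
    integer potential.  If a coordinate exceeds [top], that actor expresses the
    opinion [+1] faster than the robot acts, by a factor [expR beta] at least,
    and [capped] decreases.  If a coordinate is negative, the robot lifts it, or
    it lies so low that its own expression is fast, and [debt] decreases.  If
    all coordinates are nonnegative and two of them agree, the robot lifts both
    until one of the two expresses an opinion and they separate; [collisions]
    counts the robot steps which this takes.  Every other transition that
    increases a potential is slower by a factor [expR beta].  The potentials are
    weighted by the time scales of the transitions that make them decrease.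

    The rates of the generator are unbounded, and the generator is given only as
    the pointwise derivative at time [0] of the semigroup on bounded functions.
    The passage from drift bounds to the semigroup is a comparison principle
    ([semigroup_le_drift]), whose minimum is confined to finitely many states by
    adding a small multiple of [spread], a function with finite sublevel sets
    and bounded drift. *)

(** * Real analysis *)

Lemma near_rightP (R : realType) (p : R) (Q : R -> Prop) :
  (\forall h \near p^'+, Q h) <->
  exists2 e, 0 < e & forall h, p < h < p + e -> Q h.
Proof.
split.
  case=> e /= e0 He; exists e => // h /andP[h0 he]; apply: He => //=.
  by rewrite distrC gtr0_norm ?subr_gt0// ltrBlDl.
case=> e e0 He; near=> h; apply: He; apply/andP; split; near: h.
  exact: nbhs_right_gt.
by apply: nbhs_right_lt; rewrite ltrDl.
Unshelve. all: by end_near. Qed.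

(** Induction along the half-line: the step to the right uses one-sided
    derivatives, the step from the left uses continuity.  It replaces
    differentiability in the arguments below, which have right derivatives
    only. *)
Lemma real_induction (R : realType) (Q : R -> Prop) :
  Q 0 ->
  (forall t, 0 <= t -> Q t -> \forall h \near 0^'+, Q (t + h)) ->
  (forall t, 0 < t -> (forall s, 0 <= s < t -> Q s) -> Q t) ->
  forall t, 0 <= t -> Q t.
Proof.
move=> Q0 Qr Ql b b0.
pose A := [set t | 0 <= t <= b /\ forall s, 0 <= s <= t -> Q s].
have A0 : A 0.
  split; first by rewrite lexx.
  by move=> s s0; have -> : s = 0 by apply/le_anti; rewrite andbC.
have Aub : ubound A b by move=> t [/andP[]].
have hA : has_sup A by split; [exists 0 | exists b].
pose c := sup A.
have c0 : 0 <= c by apply: ub_le_sup => //; exists b.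
have cb : c <= b by apply: ge_sup => //; exists 0.
have Qlt s : 0 <= s < c -> Q s.
  move=> /andP[s0 sc]; have dc : 0 < c - s by rewrite subr_gt0.
  have [t [_ Ht]] := sup_adherent dc hA; rewrite subKr => st.
  by apply: Ht; rewrite s0 ltW.
have Qc : Q c.
  by have [<-//|cn0] := eqVneq 0 c; apply: Ql => //; rewrite lt_neqAle cn0.
have [<-//|cnb] := eqVneq c b.
have {cnb}cb : c < b by rewrite lt_neqAle cnb.
have /near_rightP[e e0 He] := Qr c c0 Qc; rewrite add0r in He.
pose t := Num.min b (c + e / 2).
have ct : c < t by rewrite lt_min cb ltrDl divr_gt0.
suff : A t by move=> /(ub_le_sup (ex_intro _ b Aub)); rewrite leNgt ct.
split; first by rewrite ge_min lexx (le_trans c0 (ltW ct)).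
move=> s /andP[s0 st]; have [sc|cs] := ltP s c; first by apply: Qlt; rewrite s0.
have [->//|snc] := eqVneq s c.
rewrite -(subrK c s) addrC; apply: He; rewrite subr_gt0 lt_neqAle eq_sym snc cs.
rewrite ltrBlDl; apply: (le_lt_trans st); rewrite gt_min ltrD2l ltr_pdivrMr//.
by rewrite ltr_pMr// ltr1n orbT.
Qed.

(** * Averages over a discrete state space *)

Section BoundedIntegral.
Context {d : measure_display} {T : measurableType d} {R : realType}.
Variable m : probability T R.

Lemma integrable_bounded (f : T -> R) (M : R) : measurable_fun setT f ->
  (forall x, `|f x| <= M) -> m.-integrable setT (EFin \o f).
Proof.
move=> mf fM; apply: measurable_bounded_integrable => //.
  by rewrite (le_lt_trans (probability_le1 _ _))// ltry.
exists M; split; first exact: num_real.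
by move=> x Mx y _ /=; apply: (le_trans (fM y)); exact: ltW.
Qed.

Lemma RintegralDc (f : T -> R) (M c : R) : measurable_fun setT f ->
  (forall x, `|f x| <= M) -> \int[m]_x (f x + c) = \int[m]_x f x + c.
Proof.
move=> mf fM; rewrite RintegralD//.
- by rewrite Rintegral_cst//= probability_setT mulr1.
- exact: integrable_bounded mf fM.
- exact: (@integrable_bounded _ `|c|).
Qed.

Lemma Rintegral_bounded (f : T -> R) (M : R) : measurable_fun setT f ->
  (forall x, `|f x| <= M) -> `|\int[m]_x f x| <= M.
Proof.
move=> mf fM; apply: le_trans (le_normr_Rintegral _ _) _ => //.
  exact: integrable_bounded mf fM.
have -> : M = \int[m]_x (cst M x).
  by rewrite Rintegral_cst//= probability_setT mulr1.
apply: le_Rintegral => //.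
- apply: (@integrable_bounded _ M) => [|x]; last by rewrite normr_id.
  exact: measurableT_comp.
- exact: (@integrable_bounded _ `|M|).
Qed.

End BoundedIntegral.

(** The Markov property and the invariance of a measure both say that a law is a
    mixture of laws, in terms of events.  Here this is extended to functions by
    comparing the two sides with the bind of the Giry monad. *)
Lemma integral_mixture (d1 d2 d3 d4 : measure_display)
    (T : measurableType d1) (T' : measurableType d2) (Omega : measurableType d3)
    (S : measurableType d4) (R : realType)
    (m : probability T R) (m' : probability T' R) (P : probability Omega R)
    (X : T' -> S) (Y : T -> Omega -> S)
    (mX : measurable_fun setT X) (mY : forall x, measurable_fun setT (Y x)) :
  (forall B, measurable B ->
    measurable_fun setT (fun x => P (Y x @^-1` B) : \bar R)) ->
  (forall B, measurable B ->
    m' (X @^-1` B) = (\int[m]_x P (Y x @^-1` B))%E) ->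
  forall h : S -> R, measurable_fun setT h -> (forall s, 0 <= h s) ->
  (\int[m']_x (h (X x))%:E = \int[m]_x \int[P]_w (h (Y x w))%:E)%E.
Proof.
move=> mPY mix h mh h0.
pose k x : giry S R := giry_map (mY x) P.
have mk : measurable_fun setT k.
  by apply: measurable_giry_codensity => // B mB; exact: mPY.
have mh' : measurable_fun setT (EFin \o h) by exact/measurable_EFinP.
have h0' s : (0 <= (EFin \o h) s)%E by rewrite lee_fin.
have <- : giry_int (giry_map mX m') (EFin \o h) = (\int[m']_x (h (X x))%:E)%E.
  exact: giry_int_map.
have -> : giry_int (giry_map mX m') (EFin \o h) =
    giry_int (giry_bind m mk) (EFin \o h).
  apply: eq_measure_integral => B mB _.
  rewrite [LHS]mix//; symmetry.
  by apply: (giry_int_map mk m (measurable_giry_ev mB)) => mu; exact: measure_ge0.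
rewrite giry_int_bind//; apply: eq_integral => x _.
exact: giry_int_map.
Qed.

Lemma Rintegral_mixture (d1 d2 d3 d4 : measure_display)
    (T : measurableType d1) (T' : measurableType d2) (Omega : measurableType d3)
    (S : measurableType d4) (R : realType)
    (m : probability T R) (m' : probability T' R) (P : probability Omega R)
    (X : T' -> S) (Y : T -> Omega -> S)
    (mX : measurable_fun setT X) (mY : forall x, measurable_fun setT (Y x)) :
  (forall h : S -> R, measurable_fun setT (fun x => \int[P]_w (h (Y x w)))) ->
  (forall B, measurable B ->
    m' (X @^-1` B) = (\int[m]_x P (Y x @^-1` B))%E) ->
  forall (h : S -> R) (M : R), measurable_fun setT h ->
    (forall s, `|h s| <= M) ->
  \int[m']_x (h (X x)) = \int[m]_x \int[P]_w (h (Y x w)).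
Proof.
move=> mPY mix h M mh hM.
have mhX : measurable_fun setT (h \o X) by exact: measurableT_comp.
have mhY x : measurable_fun setT (h \o Y x) by exact: measurableT_comp.
have PY x : `|\int[P]_w (h (Y x w))| <= M.
  by apply: Rintegral_bounded => //; exact: mhY.
have mPYB B : measurable B ->
    measurable_fun setT (fun x => P (Y x @^-1` B) : \bar R).
  move=> mB.
  have -> : (fun x => P (Y x @^-1` B)) =
      (fun x => (\int[P]_w (\1_B (Y x w)))%:E).
    apply/funext => x; rewrite /Rintegral fineK; last first.
      apply: integrable_fin_num => //; apply: (@integrable_bounded _ _ _ _ _ 1).
        by apply: measurableT_comp => //; exact: measurable_indic.
      by move=> w; rewrite indicE; case: (_ \in _); rewrite ?normr1 ?normr0.
    rewrite (_ : (fun w => _) = (fun w => (\1_(Y x @^-1` B) w)%:E))//.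
    rewrite integral_indic ?setIT//.
    by rewrite -[X in measurable X]setTI; exact: mY.
  by apply/measurable_EFinP; exact: (mPY (\1_B)).
have pos s : 0 <= h s + M.
  by rewrite -lerBlDr sub0r; move: (hM s); rewrite ler_norml => /andP[].
apply: (addIr M); rewrite -(RintegralDc _ M mhX (fun x => hM (X x))).
rewrite -(RintegralDc _ M (mPY h) PY).
rewrite /Rintegral; congr fine.
have mhM : measurable_fun setT (fun s => h s + M) by exact: measurable_funD.
rewrite (integral_mixture mX mY mPYB mix mhM pos).
apply: eq_integral => x _; rewrite -(RintegralDc P M (mhY x) (fun w => hM (Y x w))).
rewrite /Rintegral fineK//; apply: integrable_fin_num => //.
apply: (@integrable_bounded _ _ _ _ _ (M + M)).
  by apply: measurable_funD => //; exact: mhY.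
move=> w; apply: le_trans (ler_normD _ _) _.
have M0 : 0 <= M by exact: le_trans (normr_ge0 _) (hM (Y x w)).
by apply: lerD; [exact: hM | rewrite ger0_norm].
Qed.

(** * The semigroup of a jump process *)

Section Semigroup.
Context {d d' : measure_display} {Omega : measurableType d}
  {S : measurableType d'} {R : realType}.
Variables (P : probability Omega R) (U : S -> R -> Omega -> S)
  (G : (S -> R) -> S -> R).
Hypothesis discrete : forall A : set S, measurable A.
Hypothesis jumpU : markov_jump_process P U G.

Local Notation Pt := (semigroup P U).

Let mS d0 (T : measurableType d0) (f : S -> T) : measurable_fun setT f.
Proof. by move=> _ Y _; exact: discrete. Qed.

Let mU u (t : R) : 0 <= t -> measurable_fun setT (U u t).
Proof. exact: (mjp_measurable jumpU). Qed.

Let mfU (f : S -> R) u (t : R) : 0 <= t ->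
  measurable_fun setT (fun w => f (U u t w)).
Proof. by move=> t0; apply: measurableT_comp; [exact: mS | exact: mU]. Qed.

Let ifU (f : S -> R) (M : R) u (t : R) : 0 <= t -> (forall s, `|f s| <= M) ->
  P.-integrable setT (fun w => (f (U u t w))%:E).
Proof.
by move=> t0 fM; apply: (@integrable_bounded _ _ _ _ _ M) => //; exact: mfU.
Qed.

Lemma generator_cvg (f : S -> R) (M : R) v : (forall s, `|f s| <= M) ->
  h^-1 * (Pt h f v - f v) @[h --> 0^'+] --> G f v.
Proof.
move=> fM; apply: (mjp_generator jumpU).
exists M; split; first exact: num_real.
by move=> x Mx y _ /=; apply: (le_trans (fM y)); exact: ltW.
Qed.

Lemma semigroup0 f u : Pt 0 f u = f u.
Proof.
rewrite /semigroup (@eq_Rintegral _ _ _ _ _ (cst (f u))).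
  by rewrite Rintegral_cst//= probability_setT mulr1.
by move=> w _ /=; rewrite (mjp_start jumpU).
Qed.

Lemma semigroup_bounded (f : S -> R) (M t : R) u : 0 <= t ->
  (forall s, `|f s| <= M) ->
  `|Pt t f u| <= M.
Proof. by move=> t0 fM; apply: Rintegral_bounded => //; exact: mfU. Qed.

Lemma semigroupD (f : S -> R) (M s t : R) u : 0 <= s -> 0 <= t ->
  (forall v, `|f v| <= M) ->
  Pt (s + t) f u = Pt s (Pt t f) u.
Proof.
move=> s0 t0 fM; rewrite /semigroup.
apply: (@Rintegral_mixture _ _ _ _ _ _ _ _ _ _ _ _ _ _ _ _ _ _ _ M) => //.
- by apply: mU; exact: addr_ge0.
- by move=> w; exact: mU.
- move=> h.
  exact: (measurableT_comp (@mS _ _ (fun v => \int[P]_w h (U v t w))) (mU _ s0)).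
- move=> B mB; have hT : history U u s setT.
    by apply: sub_sigma_algebra; exists 0, setT; split; rewrite ?lexx.
  by have := mjp_markov jumpU s0 t0 hT mB; rewrite setTI.
Qed.

Lemma semigroup_affine (f : S -> R) (M t a b : R) u : 0 <= t ->
  (forall s, `|f s| <= M) -> Pt t (fun s => a + b * f s) u = a + b * Pt t f u.
Proof.
move=> t0 fM; rewrite addrC /semigroup -RintegralZl//; last exact: ifU fM.
under eq_Rintegral do rewrite addrC.
apply: (@RintegralDc _ _ _ _ _ (`|b| * M)).
  exact: (@mfU (fun s => b * f s)).
by move=> w; rewrite normrM ler_wpM2l.
Qed.

Lemma semigroup_le (f g : S -> R) (M t : R) u : 0 <= t ->
  (forall s, `|f s| <= M) -> (forall s, `|g s| <= M) ->
  (forall s, f s <= g s) -> Pt t f u <= Pt t g u.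
Proof.
by move=> t0 fM gM fg; apply: le_Rintegral => //; [exact: ifU fM | exact: ifU gM].
Qed.

(** Leaving a state takes time, so every bounded function moves little in a
    short time, at a rate that depends on its bound only.  Applied to
    [Pt s f], whose bound does not depend on [s], this gives the continuity in
    time of the semigroup on both sides. *)
Lemma semigroup_modulus (M e : R) v : 0 < e ->
  \forall h \near 0^'+, forall g : S -> R, (forall s, `|g s| <= M) ->
    `|Pt h g v - g v| <= e.
Proof.
move=> e0; pose i : S -> R := \1_[set v].
have i1 s : `|i s| <= 1.
  by rewrite /i indicE; case: (_ \in _); rewrite ?normr1 ?normr0.
have iv : i v = 1 by rewrite /i indicE mem_set.
have ch : h * (h^-1 * (Pt h i v - i v)) @[h --> 0^'+] --> 0 * G i v.
  by apply: cvgM; [exact: cvg_at_right_filter | exact: generator_cvg i1].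
have M1 : 0 < 2 * `|M| + 1 by rewrite ltr_pwDr// mulr_ge0.
have ce : 0 < e / (2 * `|M| + 1) by rewrite divr_gt0.
rewrite mul0r in ch; move/cvgrPdist_lt: ch => /(_ _ ce) ch.
near=> h => g gM.
have h0 : 0 < h by near: h; exact: nbhs_right_gt.
have : `|0 - h * (h^-1 * (Pt h i v - i v))| < e / (2 * `|M| + 1) by near: h.
rewrite mulVKf ?gt_eqF// sub0r normrN iv => hi.
have M0 : 0 <= M by exact: le_trans (normr_ge0 _) (gM v).
rewrite (ger0_norm M0) in hi M1 ce.
have ih1 : Pt h i v <= 1.
  by apply: le_trans (ler_norm _) _; exact: semigroup_bounded (ltW h0) i1.
have {}hi : 2 * M * (1 - Pt h i v) <= e.
  move: hi; rewrite ltr_pdivlMr// distrC ger0_norm ?subr_ge0//; nra.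
have aff a b : Pt h (fun s => a + b * i s) v = a + b * Pt h i v.
  exact: semigroup_affine (ltW h0) i1.
have affB (a b : R) s : `|a + b * i s| <= Num.max M (`|a| + `|b|).
  rewrite le_max; apply/orP; right; apply: le_trans (ler_normD _ _) _.
  by rewrite lerD2l normrM ler_piMr.
have gB (a b : R) s : `|g s| <= Num.max M (`|a| + `|b|) by rewrite le_max gM.
have gv s : -M <= g s <= M by rewrite -ler_norml.
have ic s : i s = 1 /\ g s = g v \/ i s = 0.
  have [->|/eqP sv] := eqVneq s v; first by left.
  by right; rewrite /i indicE memNset.
rewrite ler_norml; apply/andP; split.
- have : Pt h (fun s => g v - 2 * M + 2 * M * i s) v <= Pt h g v.
    have B s : `|g v - 2 * M + 2 * M * i s| <=
      Num.max M (`|g v - 2 * M| + `|2 * M|) by exact: affB.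
    apply: (semigroup_le _ (ltW h0) B (gB _ _)) => s.
    by have := gv s; have := gv v; have [[-> ->]|->] := ic s; lra.
  by rewrite aff; lra.
- have : Pt h g v <= Pt h (fun s => g v + 2 * M + - (2 * M) * i s) v.
    have B s : `|g v + 2 * M + - (2 * M) * i s| <=
      Num.max M (`|g v + 2 * M| + `|- (2 * M)|) by exact: affB.
    apply: (semigroup_le _ (ltW h0) (gB _ _) B) => s.
    by have := gv s; have := gv v; have [[-> ->]|->] := ic s; lra.
  by rewrite aff; lra.
Unshelve. all: by end_near. Qed.

End Semigroup.

(** * Comparison with the generator *)

Definition jump_generator (J : finType) (S : Type) (R : realType)
    (r : J -> S -> R) (T : J -> S -> S) (f : S -> R) (v : S) : R :=
  \sum_j r j v * (f (T j v) - f v).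

Lemma near_finite_set (T : Type) (I : choiceType) (F : set_system T)
    (A : set I) (Q : I -> T -> Prop) : Filter F -> finite_set A ->
  (forall i, A i -> \forall x \near F, Q i x) ->
  \forall x \near F, forall i, A i -> Q i x.
Proof.
move=> FF /finite_fsetP[X ->] H; have := filter_bigI (D := X) (f := Q) FF.
by move=> /(_ (fun i iX => H i iX)); apply: filterS => x Hx i; exact: Hx.
Qed.

Section Comparison.
Context {d d' : measure_display} {Omega : measurableType d}
  {S : measurableType d'} {R : realType} {J : finType}.
Variables (P : probability Omega R) (U : S -> R -> Omega -> S)
  (r : J -> S -> R) (T : J -> S -> S).
Hypothesis discrete : forall A : set S, measurable A.
Hypothesis r_ge0 : forall j v, 0 <= r j v.
Local Notation G := (jump_generator r T).
Hypothesis jumpU : markov_jump_process P U G.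
Variables (W : S -> R) (c : R).
Hypothesis W_ge0 : forall v, 0 <= W v.
Hypothesis W_finite : forall B, finite_set [set v | W v <= B].
Hypothesis W_drift : forall v, G W v <= c.

Local Notation Pt := (semigroup P U).

(** The difference [f v + K * t - Pt t f v], perturbed by a small multiple of
    [W v + (`|c| + 1) * t], stays nonnegative.  It is nonnegative at time [0].
    A state where it vanishes while it is nonnegative elsewhere is a minimum, so
    the generator is nonnegative there, and the perturbation makes the right
    derivative positive.  Only finitely many states can come close to zero,
    because [W] has finite sublevel sets and the rest is bounded. *)
Lemma semigroup_le_drift (f : S -> R) (M K : R) : (forall s, `|f s| <= M) ->
  (forall s, G f s <= K) -> forall t, 0 <= t -> forall v, Pt t f v <= f v + K * t.
Proof.
move=> fM fK.
pose a := `|c| + 1.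
have a0 : 0 < a by rewrite ltr_pwDr.
have ca : c + 1 <= a by rewrite lerD2r ler_norm.
suff pos e t v : 0 < e -> 0 <= t -> 0 <= f v + K * t - Pt t f v + e * (W v + a * t).
  move=> t t0 v; apply/ler_addgt0Pr => e0 e00.
  have den : 0 < W v + a * t + 1 by rewrite ltr_pwDr// addr_ge0// mulr_ge0// ltW.
  have := pos (e0 / (W v + a * t + 1)) t v (divr_gt0 e00 den) t0.
  suff : e0 / (W v + a * t + 1) * (W v + a * t) <= e0 by lra.
  by rewrite mulrAC ler_pdivrMr// ler_pM2l// lerDl.
move=> e_gt0 t_ge0.
pose z t v := f v + K * t - Pt t f v + e * (W v + a * t).
have zS t1 h v1 : 0 <= t1 -> 0 < h -> z (t1 + h) v1 =
    z t1 v1 + h * (K + e * a - h^-1 * (Pt h (Pt t1 f) v1 - Pt t1 f v1)).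
  move=> tge hgt; rewrite /z (addrC t1 h).
  rewrite (semigroupD discrete jumpU _ (ltW hgt) tge fM).
  by rewrite mulrBr mulVKf ?gt_eqF//; lra.
have Ptf t1 v1 : 0 <= t1 -> `|Pt t1 f v1| <= M.
  by move=> ?; exact: (semigroup_bounded discrete jumpU).
rewrite -/(z t v); move: t t_ge0 v.
apply: real_induction => [v|t t0 zt|t t0 zt v].
- by rewrite /z (semigroup0 jumpU) !mulr0 !addr0 subrr add0r mulr_ge0// ltW.
(* outside [F] the perturbation outweighs the bounded part up to time [t + 1] *)
- pose B := (2 * M + `|K| * (t + 1)) / e.
  pose F := [set v | W v <= B].
  have near_F : forall v, F v -> \forall h \near 0^'+, 0 <= z (t + h) v.
    move=> v _.
    pose g := G (Pt t f) v.
    have cv : h^-1 * (Pt h (Pt t f) v - Pt t f v) @[h --> 0^'+] --> g.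
      by apply: (generator_cvg jumpU) => s; exact: Ptf.
    have [zv|zv] := ltP 0 (z t v).
      have D0 : 0 < `|K + e * a - g - 1| + 1 by rewrite ltr_pwDr.
      near=> h.
      have h0 : 0 < h by near: h; exact: nbhs_right_gt.
      have hz : h < z t v / (`|K + e * a - g - 1| + 1).
        by near: h; apply: nbhs_right_lt; exact: divr_gt0.
      have hg : h^-1 * (Pt h (Pt t f) v - Pt t f v) < g + 1.
        by near: h; apply: (cvgr_lt g) => //; rewrite ltrDl.
      rewrite zS//; rewrite ltr_pdivlMr// in hz.
      have := ler_norm (- (K + e * a - g - 1)); rewrite normrN => hK.
      by have := ltW h0; nra.
    have z0 : z t v = 0 by apply/le_anti; rewrite zv zt.
      have Gmin : 0 <= \sum_j r j v * (z t (T j v) - z t v).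
      by apply: sumr_ge0 => j _; rewrite z0 subr0 mulr_ge0.
    have Glin : \sum_j r j v * (z t (T j v) - z t v) = G f v - g + e * G W v.
      rewrite /g /jump_generator mulr_sumr -sumrB -big_split/=.
      by apply: eq_bigr => j _; rewrite /z; lra.
    have gK : g < K + e * a.
      have := fK v; have := W_drift v; rewrite Glin in Gmin.
      move=> Wv fv; have : e * (G W v + 1) <= e * a by rewrite ler_pM2l//; lra.
      by lra.
    near=> h.
    have h0 : 0 < h by near: h; exact: nbhs_right_gt.
    have hg : h^-1 * (Pt h (Pt t f) v - Pt t f v) < K + e * a.
      by near: h; exact: (cvgr_lt g).
    by rewrite zS// z0 add0r mulr_ge0 ?ltW// subr_gt0.
  have := near_finite_set (at_right_proper_filter 0) (W_finite B) near_F.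
  move=> nF; near=> h => v.
  have nFh : forall v', F v' -> 0 <= z (t + h) v' by near: h.
  have h0 : 0 < h by near: h; exact: nbhs_right_gt.
  have h1 : h < 1 by near: h; exact: nbhs_right_lt.
  have [vF|] := leP (W v) B; first exact: nFh.
  rewrite /B ltr_pdivrMr// => WB.
  have := Ptf (t + h) v (addr_ge0 t0 (ltW h0)); rewrite ler_norml => /andP[_ Pv].
  have := fM v; rewrite ler_norml => /andP[fv _].
  have Kt : - (`|K| * (t + 1)) <= K * (t + h).
    have K1 : 0 <= K + `|K| by have := ler_norm (- K); rewrite normrN; lra.
    have th : 0 <= t + h by lra.
    have h1' : 0 <= 1 - h by lra.
    by have := mulr_ge0 K1 th; have := mulr_ge0 (normr_ge0 K) h1'; lra.
  have eat : 0 <= e * (a * (t + h)).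
    by rewrite mulr_ge0 ?(ltW e_gt0)// mulr_ge0 ?(ltW a0)//; lra.
  by rewrite /z mulrDr; lra.
- rewrite leNgt; apply/negP => zn.
  have M1 : 0 < `|K| + e * a + 1 by rewrite ltr_pwDr// addr_ge0// mulr_ge0// ltW.
  near (0 : R)^'+ => h.
  have h0 : 0 < h by near: h; exact: nbhs_right_gt.
  have ht : h < t by near: h; exact: nbhs_right_lt.
  have hM : h < - z t v / 2 / (`|K| + e * a + 1).
    by near: h; apply: nbhs_right_lt; rewrite !divr_gt0// oppr_gt0.
  have hP : forall g : S -> R, (forall s, `|g s| <= M) ->
      `|Pt h g v - g v| <= - z t v / 2.
    by near: h; apply: (semigroup_modulus discrete jumpU); rewrite divr_gt0// oppr_gt0.
  have th : 0 <= t - h < t by rewrite subr_ge0 ltW//= ltrBlDr ltrDl.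
  have thg := andP th; have := zt _ th v.
  have := zS (t - h) h v thg.1 h0; rewrite subrK => zE.
  have := hP _ (Ptf (t - h) ^~ thg.1).
  rewrite mulrBr mulVKf ?gt_eqF// in zE.
  rewrite ltr_pdivlMr// in hM.
  rewrite ler_norml => /andP[_ hP'] zth.
  have := ler_norm (- K); rewrite normrN => Kn.
  have : 0 < e * a by exact: mulr_gt0.
  by nra.
Unshelve. all: by end_near. Qed.

(** The generator is only a pointwise limit, so a bound on it passes to means
    through dominated convergence. *)
Lemma mean_increment_le d0 (X : measurableType d0) (m : probability X R)
    (V : X -> S) (f g : S -> R) (M K e : R) : measurable_fun setT V ->
  (forall s, `|f s| <= M) -> (forall s, `|g s| <= K) ->
  (forall s, G f s <= g s) -> 0 < e ->
  \forall h \near 0^'+,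
    \int[m]_x (Pt h f (V x) - f (V x)) <= h * (\int[m]_x g (V x) + e).
Proof.
move=> mV fM gK Gg e0.
have mV' (k : S -> R) : measurable_fun setT (fun x => k (V x)).
  by apply: measurableT_comp => // _ Y _; exact: discrete.
have GK s : G f s <= K by apply: le_trans (Gg s) (le_trans (ler_norm _) (gK s)).
(* the comparison principle bounds the difference quotients from above; the
   truncation bounds them from below and keeps their limit below [g] *)
pose psi h s := Num.max (h^-1 * (Pt h f s - f s)) (- K).
pose lim s := Num.max (G f s) (- K).
have K0 (s : S) : 0 <= K by exact: le_trans (normr_ge0 _) (gK s).
have psiK (h : R) s : 0 < h -> `|psi h s| <= K.
  move=> h0; rewrite ler_norml /psi le_max lexx orbT ge_max /=.
  rewrite ler_pdivrMl// lerBlDl mulrC (semigroup_le_drift fM GK (ltW h0))/=.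
  by apply: le_trans (K0 s); rewrite oppr_le0 (K0 s).
have limK s : `|lim s| <= K.
  rewrite ler_norml /lim le_max lexx orbT ge_max GK/= (le_trans _ (K0 s))//.
  by rewrite oppr_le0 (K0 s).
have limg s : lim s <= g s.
  by rewrite /lim ge_max Gg/=; move: (gK s); rewrite ler_norml => /andP[].
have cvg_psi : \int[m]_x psi h (V x) @[h --> 0^'+] --> \int[m]_x lim (V x).
  apply/cvg_at_rightP => u [u0 cu]; apply: fine_cvg.
  rewrite /Rintegral fineK; last first.
    apply: integrable_fin_num => //.
    by apply: (@integrable_bounded _ _ _ _ _ K) => //; exact: (mV' lim).
  apply: (@dominated_cvg _ _ _ m setT measurableT _ _ (fun=> K%:E)) => //.
  - by move=> n; apply/measurable_EFinP; exact: (mV' (psi (u n))).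
  - move=> x _; apply/cvg_EFin; first exact: nearW.
    have cps : psi h (V x) @[h --> 0^'+] --> lim (V x).
      rewrite /psi /lim.
      rewrite maxr_absE; under eq_fun => h do rewrite maxr_absE.
      have cG : h^-1 * (Pt h f (V x) - f (V x)) @[h --> 0^'+] --> G f (V x).
        exact: (generator_cvg jumpU fM).
      apply: cvgM; [|exact: cvg_cst]; apply: cvgD; first exact: cvgD cG (cvg_cst _).
      by apply: cvg_norm; exact: cvgB cG (cvg_cst _).
    by have /cvg_at_rightP := cps; apply.
  - apply: (@integrable_bounded _ _ _ _ (fun=> K) `|K|) => //.
  - by move=> n x _ /=; rewrite lee_fin psiK.
have ub : \int[m]_x lim (V x) < \int[m]_x g (V x) + e.
  rewrite ltr_pwDr//; apply: le_Rintegral => //.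
  - by apply: (@integrable_bounded _ _ _ _ _ K) => //; exact: (mV' lim).
  - by apply: (@integrable_bounded _ _ _ _ _ K) => //; exact: (mV' g).
near=> h.
have h0 : 0 < h by near: h; exact: nbhs_right_gt.
have hlt : \int[m]_x psi h (V x) < \int[m]_x g (V x) + e.
  by near: h; exact: (cvgr_lt (\int[m]_x lim (V x))).
have incM s : `|Pt h f s - f s| <= M + M.
  apply: le_trans (ler_normB _ _) _; apply: lerD => //.
  by apply: (semigroup_bounded discrete jumpU) => //; exact: ltW.
rewrite -ler_pdivrMl//; apply: le_trans (ltW hlt).
rewrite -RintegralZl//; last first.
  apply: (@integrable_bounded _ _ _ _ _ (M + M)) => //.
  exact: (mV' (fun s => Pt h f s - f s)).
apply: le_Rintegral => //.
- apply: (@integrable_bounded _ _ _ _ _ (h^-1 * (M + M))).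
    exact: (mV' (fun s => h^-1 * (Pt h f s - f s))).
  by move=> x; rewrite normrM gtr0_norm ?invr_gt0// ler_pM2l ?invr_gt0.
- apply: (@integrable_bounded _ _ _ _ _ K) => [|x]; last exact: psiK.
  exact: (mV' (psi h)).
- by move=> x _; rewrite /psi le_max lexx.
Unshelve. all: by end_near. Qed.

(** Under an invariant measure the mean increment of [f] over any time is zero. *)
Lemma invariant_drift_ge0 (nu : probability S R) (f g : S -> R) (M K : R) :
  invariant_measure P U nu ->
  (forall s, `|f s| <= M) -> (forall s, `|g s| <= K) ->
  (forall s, G f s <= g s) -> 0 <= \int[nu]_s g s.
Proof.
move=> inv fM gK Gg; apply/ler_addgt0Pr => e e0.
have mid : measurable_fun setT (@id S) by [].
have := mean_increment_le nu mid fM gK Gg e0.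
move=> ni; near (0 : R)^'+ => h.
have h0 : 0 < h by near: h; exact: nbhs_right_gt.
have : \int[nu]_x (Pt h f x - f x) <= h * (\int[nu]_x g x + e) by near: h.
have mS (k : S -> R) : measurable_fun setT k by move=> _ Y _; exact: discrete.
have Pf s : `|Pt h f s| <= M.
  by apply: (semigroup_bounded discrete jumpU) => //; exact: ltW.
rewrite RintegralB//; last 2 first.
- exact: (@integrable_bounded _ _ _ _ _ M).
- exact: (@integrable_bounded _ _ _ _ _ M).
rewrite -[X in _ - X]/(\int[nu]_s f (id s)).
rewrite (@Rintegral_mixture _ _ _ _ S S Omega S R nu nu P id
  (fun s => U s h) mid _ _ _ f M)//.
- by rewrite subrr pmulr_rge0.
- by move=> v; exact: (mjp_measurable jumpU v (ltW h0)).
- by move=> B mB; rewrite (inv h B (ltW h0)).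
Unshelve. all: by end_near. Qed.

(** While the mean of [g] is at most [- q], the mean of [f] decreases at speed
    [q] at least; [f] being nonnegative, this cannot last longer than
    [f u / q]. *)
Lemma mean_drift_time (f g : S -> R) (M K q t : R) u :
  (forall s, 0 <= f s <= M) -> (forall s, `|g s| <= K) ->
  (forall s, G f s <= g s) -> 0 <= t ->
  (forall s, 0 <= s <= t -> \int[P]_w g (U u s w) <= - q) -> q * t <= f u.
Proof.
move=> f0M gK Gg t0 gq.
have fM s : `|f s| <= M by have /andP[f0 fM] := f0M s; rewrite ger0_norm.
suff phi e s : 0 < e -> 0 <= s -> s <= t -> Pt s f u <= f u + (e - q) * s.
  apply/ler_addgt0Pr => e e0.
  have t1 : 0 < t + 1 by lra.
  have := phi (e / (t + 1)) t (divr_gt0 e0 t1) t0 (lexx t).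
  have : 0 <= Pt t f u by apply: Rintegral_ge0 => w _; have /andP[] := f0M (U u t w).
  have : e / (t + 1) * t <= e by rewrite mulrAC ler_pdivrMr// ler_pM2l// lerDl.
  by lra.
move=> e0; move: s; apply: real_induction => [_|s s0 IH|s s0 IH st].
- by rewrite (semigroup0 jumpU) mulr0 addr0.
- have mV := mjp_measurable jumpU u s0.
  have ni := mean_increment_le P mV fM gK Gg e0.
  near=> h => sht.
  have h0 : 0 < h by near: h; exact: nbhs_right_gt.
  have st : s <= t by apply: le_trans sht; rewrite lerDl ltW.
  have := IH st; have : s <= t := st.
  have := gq s; rewrite s0 st => /(_ isT) gs _ IHs.
  have inc : \int[P]_w (Pt h f (U u s w) - f (U u s w)) <=
    h * (\int[P]_w g (U u s w) + e) by near: h.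
  rewrite (semigroupD discrete jumpU u s0 (ltW h0) fM).
  have mU (k : S -> R) : measurable_fun setT (fun w => k (U u s w)).
    by apply: measurableT_comp => // _ Y _; exact: discrete.
  rewrite RintegralB// in inc; last 2 first.
  + apply: (@integrable_bounded _ _ _ _ _ M); first exact: (mU (Pt h f)).
    by move=> w; apply: (semigroup_bounded discrete jumpU) => //; exact: ltW.
  + by apply: (@integrable_bounded _ _ _ _ _ M) => //; exact: (mU f).
  have : h * (\int[P]_w g (U u s w) + e) <= h * (e - q) by rewrite ler_pM2l//; lra.
  rewrite -[X in X - _]/(Pt s (Pt h f) u) -[X in _ - X]/(Pt s f u) in inc *.
  by lra.
- rewrite leNgt; apply/negP => ns.
  set D := Pt s f u - (f u + (e - q) * s).
  have D0 : 0 < D by rewrite subr_gt0.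
  have D1 : 0 < `|e - q| + 1 by rewrite ltr_pwDr.
  near (0 : R)^'+ => h.
  have h0 : 0 < h by near: h; exact: nbhs_right_gt.
  have hs : h < s by near: h; exact: nbhs_right_lt.
  have hD : h < D / 2 / (`|e - q| + 1).
    by near: h; apply: nbhs_right_lt; rewrite !divr_gt0.
  have hP : forall g : S -> R, (forall s, `|g s| <= M) -> `|Pt h g u - g u| <= D / 2.
    by near: h; apply: (semigroup_modulus discrete jumpU); rewrite divr_gt0.
  have sh : 0 <= s - h < s by rewrite subr_ge0 ltW//= ltrBlDr ltrDl.
  have shg := andP sh.
  have Pf v : `|Pt (s - h) f v| <= M.
    by apply: (semigroup_bounded discrete jumpU) => //; exact: shg.1.
  have := hP _ Pf.
  rewrite -(semigroupD discrete jumpU u (ltW h0) shg.1 fM) (addrC h) subrK.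
  rewrite ler_norml => /andP[_ P1].
  have := IH (s - h) sh (le_trans (ltW shg.2) st).
  rewrite ltr_pdivlMr// in hD.
  have := ler_norm (- (e - q)); rewrite normrN => en.
  by rewrite -/D; rewrite /D in hD P1 *; nra.
Unshelve. all: by end_near. Qed.

End Comparison.

(** * Hitting times *)

Section HittingTime.
Context {d d' : measure_display} {Omega : measurableType d}
  {S : measurableType d'} {R : realType}.
Variables (P : probability Omega R) (U : S -> R -> Omega -> S)
  (G : (S -> R) -> S -> R).
Hypothesis discrete : forall A : set S, measurable A.
Hypothesis jumpU : markov_jump_process P U G.
Variables (u : S) (B : set S) (t : R).
Hypothesis t_gt0 : 0 < t.

Let late := [set w | (t%:E < hitting_time U u B w)%E].

(** At time [t] itself the process may not be in [B]: by right continuity it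
    stays where it is for a while, which moves the infimum beyond [t]. *)
Lemma hitting_time_gtP :
  late = [set w | forall s, 0 < s <= t -> ~ B (U u s w)].
Proof.
apply/seteqP; split=> w /=; rewrite /late /=.
  move=> tw s /andP[s0 st] Bs; move: tw; rewrite ltNge => /negP; apply.
  apply: (@le_trans _ _ s%:E); last by rewrite lee_fin.
  by apply: ereal_inf_lbound; exists s.
move=> nB; have /near_rightP[e e0 He] := mjp_right jumpU u w (ltW t_gt0).
apply: (@lt_le_trans _ _ (t + e)%:E); first by rewrite lte_fin ltrDl.
apply: le_ereal_inf_tmp => _ [s [s0 Bs] <-]; rewrite lee_fin leNgt; apply/negP => ste.
have [st|ts] := leP s t; first by apply: nB Bs; rewrite s0.
by move: Bs; rewrite He ?ts//; apply: nB; rewrite t_gt0 lexx.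
Qed.

(** The time [0], which the hitting time ignores, is included by right
    continuity. *)
Lemma late_subset s : 0 <= s <= t -> late `<=` [set w | ~ B (U u s w)].
Proof.
move=> /andP[s0 st] w; rewrite hitting_time_gtP /= => nB.
have [{s0}s0|s0'] := ltP 0 s; first by apply: nB; rewrite s0.
have -> : s = 0 by apply/le_anti; rewrite s0' s0.
have /near_rightP[e e0] := mjp_right jumpU u w (lexx 0); rewrite add0r => He.
pose h := Num.min t (e / 2).
have h0 : 0 < h by rewrite lt_min t_gt0 divr_gt0.
rewrite -(He h); first by apply: nB; rewrite h0 ge_min lexx.
by rewrite h0 gt_min ltr_pdivrMr// ltr_pMr// ltr1n orbT.
Qed.

Let mUB (s : R) (C : set S) : 0 <= s -> measurable [set w | C (U u s w)].
Proof.
move=> s0; rewrite -[X in measurable X]setTI.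
exact: (mjp_measurable jumpU u s0 measurableT (discrete C)).
Qed.

(** A visit to [B] before [t] lasts for some time, hence contains a rational
    time. *)
Lemma measurable_late : measurable late.
Proof.
pose F (q : rat) := [set w | 0 < (ratr q : R) < t /\ B (U u (ratr q : R) w)].
have -> : late = ~` ((\bigcup_q F q) `|` [set w | B (U u t w)]).
  rewrite hitting_time_gtP; apply/seteqP; split=> w /= nB.
    move=> [[q _ [/andP[q0 qt] Bq]]|]; first by apply: nB Bq; rewrite q0 ltW.
    by apply: nB; rewrite t_gt0 lexx.
  move=> s /andP[s0]; rewrite le_eqVlt => /predU1P[->|st] Bs.
    by apply: nB; right.
  have /near_rightP[e e0 He] := mjp_right jumpU u w (ltW s0).
  have /rat_in_itvoo[q] : s < Num.min t (s + e) by rewrite lt_min st ltrDl.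
  rewrite in_itv/= lt_min => /and3P[sq qt qe].
  apply: nB; left; exists q => //; split; first by rewrite qt (lt_trans s0).
  by rewrite He// sq.
apply: measurableC; apply: measurableU; last exact/mUB/ltW.
apply: bigcupT_measurable_rat => q.
have [/andP[q0 qt]|nq] := boolP (0 < (ratr q : R) < t).
  rewrite (_ : F q = [set w | B (U u (ratr q) w)]); first exact/mUB/ltW.
  by apply/seteqP; split => w /=; [case|split => //; apply/andP].
rewrite (_ : F q = set0)//; apply/seteqP; split => w //= [].
by rewrite (negPf nq).
Qed.

End HittingTime.

Lemma Rintegral_cB1 (d : measure_display) (T : measurableType d) (R : realType)
    (m : probability T R) (A : set T) (c : R) : measurable A ->
  \int[m]_x (c - \1_A x) = c - fine (m A).
Proof.
move=> mA.
have i1 x : `|- (\1_A x : R)| <= 1.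
  by rewrite normrN indicE; case: (_ \in _); rewrite ?normr1 ?normr0.
have mi : measurable_fun setT (fun x => - (\1_A x : R)).
  by apply: measurable_funN; exact: measurable_indic.
under eq_Rintegral do rewrite addrC.
rewrite (RintegralDc m c mi i1) addrC; congr (_ + _).
under eq_Rintegral do rewrite -mulN1r.
rewrite RintegralZl//; last first.
  apply: (@integrable_bounded _ _ _ _ _ 1) => [|x]; first exact: measurable_indic.
  by rewrite -normrN.
by rewrite mulN1r /Rintegral integral_indic// setIT.
Qed.

Section FosterLyapunov.
Context {d d' : measure_display} {Omega : measurableType d}
  {S : measurableType d'} {R : realType} {J : finType}.
Variables (P : probability Omega R) (U : S -> R -> Omega -> S)
  (r : J -> S -> R) (T : J -> S -> S).
Hypothesis discrete : forall A : set S, measurable A.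
Hypothesis r_ge0 : forall j v, 0 <= r j v.
Local Notation G := (jump_generator r T).
Hypothesis jumpU : markov_jump_process P U G.
Variables (W : S -> R) (b : R).
Hypothesis W_ge0 : forall v, 0 <= W v.
Hypothesis W_finite : forall B, finite_set [set v | W v <= B].
Hypothesis W_drift : forall v, G W v <= b.
Variables (f : S -> R) (M c : R) (B : set S).
Hypothesis f_bounded : forall s, 0 <= f s <= M.
Hypothesis f_drift : forall s, G f s <= c - \1_(~` B) s.

Let gK s : `|c - \1_(~` B) s| <= `|c| + 1.
Proof.
apply: le_trans (ler_normB _ _) _; rewrite lerD2l indicE.
by case: (_ \in _); rewrite ?normr1 ?normr0.
Qed.

Lemma invariant_mass_ge (nu : probability S R) : invariant_measure P U nu ->
  ((1 - c)%:E <= nu B)%E.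
Proof.
move=> inv.
have fM s : `|f s| <= M by have /andP[f0 fM] := f_bounded s; rewrite ger0_norm.
have := invariant_drift_ge0 discrete r_ge0 jumpU W_ge0 W_finite W_drift
  inv fM gK f_drift.
rewrite Rintegral_cB1// probability_setC//.
have /fineK <- := fin_num_measure nu B (discrete B).
by rewrite -EFinB lee_fin/=; lra.
Qed.

(** On the event that [B] is hit after [t], the process is off [B] at every time
    up to [t], so the probability of that event bounds from below the mean of
    the indicator of the complement of [B] at all these times. *)
Lemma hitting_time_tail u t : 0 < t ->
  (P [set w | (t%:E < hitting_time U u B w)%E] <= (f u / t + c)%:E)%E.
Proof.
move=> t0; set late := [set w | _].
have mlate : measurable late by exact: (measurable_late discrete jumpU).
have /fineK <- := fin_num_measure P late mlate.
rewrite lee_fin -lerBlDr ler_pdivlMr//.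
apply: (mean_drift_time discrete r_ge0 jumpU W_ge0 W_finite W_drift
  f_bounded gK f_drift (ltW t0)) => s /andP[s0 st].
have mnB : measurable [set w | ~ B (U u s w)].
  rewrite -[X in measurable X]setTI.
  exact: (mjp_measurable jumpU u s0 measurableT (discrete (~` B))).
rewrite opprB -[X in X <= _]/(\int[P]_w (c - \1_[set w | ~ B (U u s w)] w)).
rewrite Rintegral_cB1// lerD2l lerN2 fine_le ?fin_num_measure//.
apply: le_measure; rewrite ?inE//.
by apply: (late_subset jumpU t0); rewrite s0.
Qed.

End FosterLyapunov.

(** * Jumps of the network *)

Section JumpGenerator.
Context {J : finType} {S : Type} {R : realType}.
Variables (r : J -> S -> R) (T : J -> S -> S).
Local Notation G := (jump_generator r T).

Lemma jump_generator_le (f : S -> R) (v : S) (B : R) :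
  (forall j, r j v * (f (T j v) - f v) <= B) -> G f v <= #|J|%:R * B.
Proof.
move=> H; rewrite /jump_generator.
apply: (@le_trans _ _ (\sum_(j : J) B)); first exact: ler_sum.
by rewrite sumr_const mulr_natl.
Qed.

(** The transition [j0] is the one that makes the potential decrease. *)
Lemma jump_generator_le_drop (f : S -> R) (v : S) (B D : R) (j0 : J) : 0 <= B ->
  (forall j, r j v * (f (T j v) - f v) <= B) ->
  r j0 v * (f (T j0 v) - f v) <= - D -> G f v <= #|J|%:R * B - D.
Proof.
move=> B0 H H0; rewrite /jump_generator (bigD1 j0)//= addrC lerD//.
apply: (@le_trans _ _ (\sum_(j | j != j0) B)); first exact: ler_sum.
by rewrite sumr_const -[X in X <= _]mulr_natl ler_wpM2r// ler_nat max_card.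
Qed.

Lemma jump_generator_comb (f g k : S -> R) (a b c : R) v :
  G (fun s => a * f s + b * g s + c * k s) v = a * G f v + b * G g v + c * G k v.
Proof.
rewrite /jump_generator !mulr_sumr -!big_split.
by apply: eq_bigr => j _ /=; lra.
Qed.

(** A transition does no harm if it does not increase the potential, or if its
    rate is small. *)
Lemma jump_term_le (x rho : R) (a b n : int) : 0 <= x -> 0 <= rho -> 0 <= n ->
  a <= b \/ (x <= rho /\ a <= b + n) -> x * (a%:~R - b%:~R) <= rho * n%:~R.
Proof.
move=> x0 rho0 n0 [ab|[xr ab]].
  apply: (@le_trans _ _ 0); last by rewrite mulr_ge0// ler0z.
  by rewrite mulr_ge0_le0// subr_le0 ler_int.
apply: (@le_trans _ _ (x * n%:~R)); last by rewrite ler_wpM2r// ler0z.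
by rewrite ler_wpM2l// lerBlDl -rmorphD/= ler_int.
Qed.

Lemma jump_term_le_drop (x D : R) (a b : int) : 0 <= D -> D <= x -> a <= b - 1 ->
  x * (a%:~R - b%:~R) <= - D.
Proof.
move=> D0 Dx ab; have : a%:~R - b%:~R <= -1 :> R.
  by rewrite lerBlDl -[-1]/((-1)%:~R) -rmorphD/= ler_int.
by nra.
Qed.

End JumpGenerator.

Definition event (N : nat) : finType := (bool * 'I_N + unit)%type.

Definition opinion (s : bool) : int := if s then 1 else -1.

Section NetworkJumps.
Context {R : realType} {N : nat}.
Variables alpha beta : R.

Definition event_rate (j : event N) (u : state N) : R :=
  match j with
  | inl (o, a) => expR (beta * (opinion o)%:~R * (u a)%:~R)
  | inr _ => expR (beta * alpha)
  end.

Definition event_jump (j : event N) (u : state N) : state N :=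
  match j with
  | inl (o, a) => express a (opinion o) u
  | inr _ => robot_express u
  end.

Lemma event_rate_ge0 j u : 0 <= event_rate j u.
Proof. by case: j => [[s a]|[]]; exact: expR_ge0. Qed.

Lemma generatorE : generator beta alpha = jump_generator event_rate event_jump.
Proof.
apply/funext => f; apply/funext => v.
rewrite /generator /jump_generator big_sumType/= !big_cons big_nil addr0.
congr (_ + _); last by rewrite (big_pred1 tt) => [|[]].
pose F (s : bool) a := expR (beta * (opinion s)%:~R * (v a)%:~R) *
  (f (express a (opinion s) v) - f v).
rewrite [RHS](eq_bigr (fun p => F p.1 p.2)); last by case.
rewrite -(pair_bigA _ F)/=.
by rewrite big_bool/= addrC.
Qed.

End NetworkJumps.

(** * Integer potentials *)

Section CoordinateSums.
Context {N : nat}.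

Definition coord_sum (h : int -> int) (u : state N) : int := \sum_a h (u a).

(** The actor who speaks gives up its own share [h (u a)] of the potential, and
    each of the [N - 1] others gains at most [d]. *)
Lemma coord_sum_express (h : int -> int) a (o d : int) (u : state N) : h 0 = 0 ->
  (forall x, h (x + o) <= h x + d) ->
  coord_sum h (express a o u) <= coord_sum h u + d * (N%:Z - 1) - h (u a).
Proof.
move=> h0 hd; rewrite /coord_sum (bigD1 a)//= [X in _ <= X + _ - _](bigD1 a)//=.
rewrite ffunE eqxx h0.
have : \sum_(i < N | i != a) h (express a o u i) <=
    \sum_(i < N | i != a) (h (u i) + d).
  by apply: ler_sum => i ia; rewrite ffunE (negPf ia).
rewrite big_split/= sumr_const.
have -> : #|[pred i | i != a]| = N.-1 by rewrite cardC1 card_ord.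
have : (0 < N)%N by case: (N) a => [[]|].
rewrite -mulr_natr natz => N0; have -> : N.-1%:Z = N%:Z - 1 by lia.
by move: (\sum_(i < N | i != a) _) (\sum_(i < N | i != a) _) (h (u a)); lia.
Qed.

Lemma coord_sum_robot (h : int -> int) (d : int) (u : state N) :
  (forall x, h (x + 1) <= h x + d) ->
  coord_sum h (robot_express u) <= coord_sum h u + d * N%:Z.
Proof.
move=> hd; rewrite /coord_sum.
have : \sum_(i < N) h (robot_express u i) <= \sum_(i < N) (h (u i) + d).
  by apply: ler_sum => i ia; rewrite ffunE.
by rewrite big_split/= sumr_const card_ord -mulr_natr natz.
Qed.

(** The confining function of the comparison principle. *)
Definition spread (u : state N) : int := coord_sum (fun x => `|x|) u.

Lemma spread_finite (R : realType) (B : R) :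
  finite_set [set u : state N | (spread u)%:~R <= B].
Proof.
have [k Bk] : exists k : nat, `|B| < k.+1%:R.
  by exists (Num.truncn `|B|); exact: truncnS_gt.
pose e (x : {ffun 'I_N -> 'I_(k + k).+1}) : state N :=
  [ffun a => (x a : nat)%:Z - k%:Z].
apply: (@sub_finite_set _ _ (e @` setT)); last exact/finite_image/finite_finset.
move=> u /= uB.
have uk a : - k%:Z <= u a <= k%:Z.
  rewrite -ler_norml; have : `|u a| <= spread u.
    by rewrite /spread /coord_sum (bigD1 a)//= lerDl sumr_ge0.
  move=> /le_trans; apply.
  have : (spread u)%:~R < (k%:Z + 1)%:~R :> R.
    apply: le_lt_trans uB _; apply: le_lt_trans (ler_norm _) _.
    by rewrite rmorphD/= natr1.
  by rewrite ltr_int; lia.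
exists [ffun a => inord (absz (u a + k%:Z))] => //.
apply/ffunP => a; rewrite !ffunE.
have [y -> yk] : exists2 y : int, u a = y & - k%:Z <= y <= k%:Z.
  by exists (u a); last exact: uk.
by rewrite inordK; lia.
Qed.

(** The cap [N] is the least one for which an actor at the cap loses more,
    when it speaks, than the [N - 1] others can gain. *)
Definition capped (u : state N) : int := coord_sum (fun x => Num.min `|x| N%:Z) u.

Lemma capped_bounds u : 0 <= capped u <= N%:Z * N%:Z.
Proof.
apply/andP; split; first by apply: sumr_ge0 => a _; lia.
apply: (@le_trans _ _ (\sum_(a < N) N%:Z)); first by apply: ler_sum => a _; lia.
by rewrite sumr_const card_ord -mulr_natr natz.
Qed.

Definition nonneg (u : state N) : bool := [forall a, 0 <= u a].

(** The events that do not lower the coordinates of the silent actors. *)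
Definition raises (j : event N) : bool :=
  if j is inl (false, _) then false else true.

Lemma raisesP u (j : event N) a : raises j ->
  event_jump j u a = u a + 1 \/
  (event_jump j u a = 0 /\ j = inl (true, a)).
Proof.
case: j => [[[] b]|[]] //= _; rewrite ffunE; last by left.
by have [->|ab] := eqVneq a b; [right|left].
Qed.

Lemma nonneg_jump u (j : event N) : raises j -> nonneg u ->
  nonneg (event_jump j u).
Proof.
move=> jr /forallP u0; apply/forallP => a.
have := u0 a; have [->|[-> _]] := raisesP u a jr => //.
by move: (u a) => y; lia.
Qed.

End CoordinateSums.

(** There are [N * N] pairs of actors, and a collision at a nonnegative height
    weighs at most [1 + top]. *)
Definition max_collisions (N : nat) (top : int) : int :=
  N%:Z * N%:Z * (1 + top).

Section TopPotentials.
Context {N : nat}.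
Variable top : int.
Hypothesis top_ge : N%:Z <= top.

(** The robot repays one unit of debt for each negative coordinate from
    [- top] on.  A coordinate below [- top] is out of its reach because of the cap,
    but such an actor speaks faster than the robot, and then [top] is repaid
    while the others borrow at most [N - 1], which is less. *)
Definition debt (u : state N) : int :=
  coord_sum (fun x => Num.min (Num.max (- x) 0) top) u.

Lemma debt_bounds u : 0 <= debt u <= N%:Z * top.
Proof.
apply/andP; split; first by apply: sumr_ge0 => a _; lia.
apply: (@le_trans _ _ (\sum_(a < N) top)); first by apply: ler_sum => a _; lia.
by rewrite sumr_const card_ord -mulr_natr natz mulrC.
Qed.

Lemma debt_express a (s : bool) (u : state N) : debt (express a (opinion s) u) <=
  debt u + (if s then 0 else N%:Z - 1) - Num.min (Num.max (- u a) 0) top.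
Proof.
rewrite /debt.
have := @coord_sum_express N (fun x => Num.min (Num.max (- x) 0) top) a
  (opinion s) (if s then 0 else 1) u.
case: s => /=; rewrite ?mul0r ?mul1r => H; apply: H => [|x]; lia.
Qed.

(** A collision at height [x] lasts until one of the two actors speaks, which
    becomes faster than the robot at the height [top]: the robot needs
    [top - x] steps to lift the pair there, and one more step separates it. *)
Definition collision_weight (u : state N) (p : 'I_N * 'I_N) : int :=
  if (p.1 != p.2) && (u p.1 == u p.2) then 1 + Num.max (top - u p.1) 0 else 0.

(** Outside the nonnegative orthant the value is the maximal one, so that
    entering the orthant costs nothing. *)
Definition collisions (u : state N) : int :=
  if nonneg u then \sum_p collision_weight u p else max_collisions N top.

Lemma collisions_bounds u : 0 <= collisions u <= max_collisions N top.
Proof.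
rewrite /collisions.
have max0 : 0 <= max_collisions N top by rewrite /max_collisions; nia.
case: ifP => [/forallP u0|_]; last by rewrite max0 lexx.
apply/andP; split.
  by apply: sumr_ge0 => p _; rewrite /collision_weight; case: ifP => // _; lia.
apply: (@le_trans _ _ (\sum_(p : 'I_N * 'I_N) (1 + top))).
  apply: ler_sum => p _; rewrite /collision_weight; have := u0 p.1.
  by case: ifP => _; move: (u p.1) => y y0; lia.
by rewrite sumr_const card_prod card_ord -mulr_natl natz PoszM.
Qed.

Lemma collision_weight_ge0 u p : 0 <= collision_weight u p.
Proof. by rewrite /collision_weight; case: ifP => // _; move: (u p.1) => y; lia. Qed.

(** An actor that expresses the opinion [1] in the nonnegative orthant falls to
    [0] while all the others rise to [1] at least: collisions are never created,
    and those which persist are lifted. *)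
Lemma collision_weight_raise u (j : event N) p : raises j -> nonneg u ->
  collision_weight (event_jump j u) p <= collision_weight u p.
Proof.
move=> jr /forallP u0; have w0 := collision_weight_ge0 u p.
rewrite [X in X <= _]/collision_weight; case: ifP => // /andP[p12 /eqP].
have := u0 p.1; have := u0 p.2.
have [->|[-> j1]] := raisesP u p.1 jr; have [->|[-> j2]] := raisesP u p.2 jr.
- rewrite /collision_weight p12 /= => _ _ /addIr ->; rewrite eqxx.
  by move: (u p.2) => y; lia.
- by move: (u p.1) (u p.2) => x y; lia.
- by move: (u p.1) (u p.2) => x y; lia.
- by move: j2 p12; rewrite j1 => -[->]; rewrite eqxx.
Qed.

Lemma collisions_raise u (j : event N) : raises j ->
  collisions (event_jump j u) <= collisions u.
Proof.
move=> jr; rewrite [X in _ <= X]/collisions; case: ifP => u0; last first.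
  by have /andP[] := collisions_bounds (event_jump j u).
rewrite /collisions (nonneg_jump jr u0); apply: ler_sum => p _.
exact: collision_weight_raise.
Qed.

Lemma collisions_raise_drop u (j : event N) p : raises j -> nonneg u ->
  collision_weight (event_jump j u) p <= collision_weight u p - 1 ->
  collisions (event_jump j u) <= collisions u - 1.
Proof.
move=> jr u0 pd; rewrite /collisions u0 (nonneg_jump jr u0).
rewrite (bigD1 p)//= [X in _ <= X - 1](bigD1 p)//=.
have : \sum_(i | i != p) collision_weight (event_jump j u) i <=
       \sum_(i | i != p) collision_weight u i.
  by apply: ler_sum => i _; exact: collision_weight_raise.
by move: (\sum_(i | _) _) (\sum_(i | _) _) => X Y; lia.
Qed.

End TopPotentials.

(** * Drift of the potentials *)

Definition lyapunov_max (R : realType) (N : nat) (alpha : R) : R :=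
  let top := Num.floor alpha + 1 in
  (N%:Z * N%:Z + N%:Z * top + max_collisions N top)%:~R.

(** Each event contributes at most [N] to the drift of each of [capped] and
    [debt], and [2 * N ^+ 2] to that of [collisions], in units of
    [expR (- beta)] and after weighting. *)
Definition drift_constant (R : realType) (N : nat) : R :=
  #|event N|%:R * (2 * N%:R + 2 * N%:R ^+ 2).

Section Drift.
Context {R : realType} {N : nat}.
Variables alpha beta : R.
Hypothesis beta_ge0 : 0 <= beta.
Hypothesis alpha_gt : N%:R - 1 < alpha.
Local Notation top := (Num.floor alpha + 1).
Local Notation rate := (event_rate alpha beta).
Local Notation G := (jump_generator rate event_jump).

Lemma top_gt : alpha < top%:~R.
Proof. by rewrite floorD1_gt// num_real. Qed.

Lemma top_le : top%:~R <= alpha + 1.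
Proof. by rewrite rmorphD/= lerD2r floor_le_tmp. Qed.

Lemma top_ge : N%:Z <= top.
Proof.
suff : N%:Z - 1 < top by lia.
rewrite -(@ltr_int R); apply: le_lt_trans top_gt; apply: le_trans (ltW alpha_gt).
by rewrite rmorphB.
Qed.

(** An actor at height [N - 1] or more, in absolute value, cannot increase the
    potential by speaking; an actor below speaks no faster than the robot
    because [N - 2 < alpha]. *)
Lemma lipschitz_term (h : int -> int) (u : state N) (j : event N) : h 0 = 0 ->
  (forall x, 0 <= h x) -> (forall x, h (x + 1) <= h x + 1) ->
  (forall x, h (x - 1) <= h x + 1) ->
  (forall x, N%:Z - 1 <= `|x| -> N%:Z - 1 <= h x) ->
  rate j u * ((coord_sum h (event_jump j u))%:~R - (coord_sum h u)%:~R)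
    <= expR (beta * alpha) * N%:Z%:~R.
Proof.
move=> h0 hp h1 h1' hN; apply: jump_term_le; [|exact: expR_ge0|by []|].
  exact: event_rate_ge0.
case: j => [[s a]|[]] /=; last first.
  by right; split => //; have := coord_sum_robot u h1; lia.
have Hs : coord_sum h (express a (opinion s) u) <=
    coord_sum h u + (N%:Z - 1) - h (u a).
  have := @coord_sum_express N h a (opinion s) 1 u h0; rewrite mul1r; apply => x.
  by case: s => /=.
have [ua|ua] := leP (N%:Z - 1) `|u a|; first by left; have := hN _ ua; lia.
right; split; last by have := hp (u a); lia.
rewrite ler_expR -mulrA ler_wpM2l// -rmorphM/=.
apply: le_trans (ltW alpha_gt).
have -> : (N%:R - 1 : R) = (N%:Z - 1)%:~R by rewrite rmorphB.
by rewrite ler_int; case: s {Hs} => /=; lia.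
Qed.

Lemma spread_drift (u : state N) :
  G (fun v : state N => (spread v)%:~R) u <=
  #|event N|%:R * (expR (beta * alpha) * N%:Z%:~R).
Proof.
by apply: jump_generator_le => j; apply: lipschitz_term => // x; lia.
Qed.

Lemma capped_term (u : state N) (j : event N) :
  rate j u * ((capped (event_jump j u))%:~R - (capped u)%:~R) <=
  expR (beta * alpha) * N%:Z%:~R.
Proof. by apply: lipschitz_term => [|x|x|x|x]; lia. Qed.

Lemma capped_drift (u : state N) :
  G (fun v : state N => (capped v)%:~R) u <=
  #|event N|%:R * (expR (beta * alpha) * N%:Z%:~R).
Proof. by apply: jump_generator_le => j; exact: capped_term. Qed.

(** The rate of this actor exceeds that of the robot by the factor [expR beta] at
    least, since [alpha < top]. *)
Lemma capped_drift_drop (u : state N) a : top < (u a : int) ->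
  G (fun v : state N => (capped v)%:~R) u <=
  #|event N|%:R * (expR (beta * alpha) * N%:Z%:~R) - expR (beta * (top + 1)%:~R).
Proof.
move=> ua; apply: (@jump_generator_le_drop _ _ _ _ _ _ _ _ _ (inl (true, a))).
- by rewrite mulr_ge0 ?expR_ge0// ler0z.
- by move=> j; exact: capped_term.
- apply: jump_term_le_drop; first exact: expR_ge0.
    by rewrite ler_expR mulr1 ler_wpM2l// ler_int lezD1.
  have c0 : Num.min `|0 : int| N%:Z = 0 by lia.
  have := @coord_sum_express N (fun x => Num.min `|x| N%:Z) a 1 1 u c0.
  rewrite -[event_jump _ _]/(express a 1 u) /capped.
  have := top_ge; move=> tN H.
  have /H : forall x : int, Num.min `|x + 1| N%:Z <= Num.min `|x| N%:Z + 1.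
    by move=> x; lia.
  have -> : Num.min `|u a| N%:Z = N%:Z by lia.
  by rewrite mul1r; lia.
Qed.

(** Debt is increased only by actors above [- (N - 1)] who express the opinion
    [-1]; since [N - 1 < alpha], they are slower than the robot by the factor
    [expR beta] at least. *)
Lemma debt_term (u : state N) (j : event N) :
  rate j u * ((debt top (event_jump j u))%:~R - (debt top u)%:~R) <=
  expR (beta * (N%:R - 2)) * N%:Z%:~R.
Proof.
have := top_ge => tN.
apply: jump_term_le; [exact: event_rate_ge0|exact: expR_ge0|by []|].
case: j => [[s a]|[]] /=; last first.
  left; rewrite /debt.
  have := @coord_sum_robot N (fun x => Num.min (Num.max (- x) 0) top) 0 u.
  by rewrite mul0r addr0; apply=> x; lia.
have := debt_express tN a s u; case: s => /= Hs; first by left; lia.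
have [ua|ua] := leP (N%:Z - 1) (- (u a : int)); first by left; lia.
right; split; last by lia.
rewrite ler_expR -mulrA ler_wpM2l// -rmorphM/=.
have -> : (N%:R - 2 : R) = (N%:Z - 2)%:~R by rewrite rmorphB.
by rewrite ler_int; lia.
Qed.

Lemma debt_drift (u : state N) : G (fun v : state N => (debt top v)%:~R) u <=
  #|event N|%:R * (expR (beta * (N%:R - 2)) * N%:Z%:~R).
Proof. by apply: jump_generator_le => j; exact: debt_term. Qed.

Lemma debt_drift_drop (u : state N) a : (u a : int) < 0 ->
  G (fun v : state N => (debt top v)%:~R) u <=
  #|event N|%:R * (expR (beta * (N%:R - 2)) * N%:Z%:~R) - expR (beta * alpha).
Proof.
move=> ua; have := top_ge => tN.
have rho0 : 0 <= expR (beta * (N%:R - 2)) * N%:Z%:~R :> R.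
  by rewrite mulr_ge0 ?expR_ge0// ler0z.
have [ta|ta] := leP (- (u a : int)) top.
- apply: (@jump_generator_le_drop _ _ _ _ _ _ _ _ _ (inr tt)) => //.
    by move=> j; exact: debt_term.
  apply: jump_term_le_drop; [exact: expR_ge0|by []|].
  rewrite /= /debt /coord_sum (bigD1 a)//= [X in _ <= X - _](bigD1 a)//=.
  have : \sum_(i < N | i != a) Num.min (Num.max (- robot_express u i) 0) top <=
         \sum_(i < N | i != a) Num.min (Num.max (- u i) 0) top.
    by apply: ler_sum => i _; rewrite ffunE; lia.
  rewrite ffunE; move: (\sum_(i < N | i != a) _) (\sum_(i < N | i != a) _) => X Y.
  by move: (u a) ua ta => y; lia.
- apply: (@jump_generator_le_drop _ _ _ _ _ _ _ _ _ (inl (false, a))) => //.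
    by move=> j; exact: debt_term.
  apply: jump_term_le_drop; first exact: expR_ge0.
    rewrite ler_expR -mulrA ler_wpM2l// -rmorphM/=.
    by apply: le_trans (ltW top_gt) _; rewrite ler_int; lia.
  by have := debt_express tN a false u; rewrite /=; lia.
Qed.

(** In the nonnegative orthant only the opinion [-1] can increase the potential,
    and there it is expressed at rate at most [1]. *)
Lemma collisions_term (u : state N) (j : event N) :
  rate j u * ((collisions top (event_jump j u))%:~R - (collisions top u)%:~R) <=
  (max_collisions N top)%:~R.
Proof.
have /andP[c0 cm] := collisions_bounds top_ge u.
have /andP[c0' cm'] := collisions_bounds top_ge (event_jump j u).
rewrite -[X in _ <= X]mul1r; apply: jump_term_le => //.
- exact: event_rate_ge0.
- exact: le_trans cm.
have [jr|jr] := boolP (raises j); first by left; exact: (collisions_raise top_ge).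
have [u0|u0] := boolP (nonneg u); last first.
  by left; rewrite [X in _ <= X]/collisions (negPf u0).
right; split; last by lia.
case: j jr {c0' cm'} => [[[] a]|[]] //= _.
rewrite -[X in _ <= X]expR0 ler_expR -mulrA mulr_ge0_le0// -rmorphM/= lerz0.
by have /forallP /(_ a) := u0; move: (u a) => y; lia.
Qed.

Lemma collisions_drift (u : state N) :
  G (fun v : state N => (collisions top v)%:~R) u <=
  #|event N|%:R * (max_collisions N top)%:~R.
Proof. by apply: jump_generator_le => j; exact: collisions_term. Qed.

Lemma collisions_drift_drop (u : state N) a b : nonneg u -> a != b -> u a = u b ->
  G (fun v : state N => (collisions top v)%:~R) u <=
  #|event N|%:R * (max_collisions N top)%:~R - expR (beta * alpha).
Proof.
move=> u0 ab uab.
have max0 : 0 <= (max_collisions N top)%:~R :> R.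
  by rewrite ler0z; have /andP[] := collisions_bounds top_ge u; exact: le_trans.
have wu : collision_weight top u (a, b) = 1 + Num.max (top - u a) 0.
  by rewrite /collision_weight /= ab uab eqxx.
have [ta|ta] := ltP (u a : int) top.
- apply: (@jump_generator_le_drop _ _ _ _ _ _ _ _ _ (inr tt)) => //.
    by move=> j; exact: collisions_term.
  apply: jump_term_le_drop; [exact: expR_ge0|by []|].
  apply: (collisions_raise_drop top_ge (p := (a, b))) => //; rewrite wu.
  rewrite /collision_weight /= !ffunE uab eqxx ab /=.
  by rewrite uab in ta; move: (u b) ta => y; lia.
- apply: (@jump_generator_le_drop _ _ _ _ _ _ _ _ _ (inl (true, a))) => //.
    by move=> j; exact: collisions_term.
  apply: jump_term_le_drop; first exact: expR_ge0.
    rewrite ler_expR mulr1 ler_wpM2l//; apply: le_trans (ltW top_gt) _.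
    by rewrite ler_int.
  apply: (collisions_raise_drop top_ge (p := (a, b))) => //; rewrite wu.
  rewrite /collision_weight /= !ffunE eqxx [b == a]eq_sym (negPf ab) /=.
  have /forallP /(_ b) := u0; case: ifP => [/eqP|_ _].
    by move: (u b) => y; lia.
  by move: (u a) => y; lia.
Qed.

(** Each weight is the inverse of the rate at which the potential decreases: the
    rate of an actor above [top] for [capped], the rate of the robot for the two
    others. *)
Definition lyapunov (u : state N) : R :=
  expR (- (beta * (top + 1)%:~R)) * (capped u)%:~R +
  expR (- (beta * alpha)) * (debt top u)%:~R +
  expR (- (beta * alpha)) * (collisions top u)%:~R.

Lemma lyapunov_bounds (u : state N) :
  0 <= lyapunov u <= expR (- (beta * alpha)) * lyapunov_max N alpha.
Proof.
have /andP[c0 c1] := capped_bounds u; have /andP[d0 d1] := debt_bounds top_ge u.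
have /andP[k0 k1] := collisions_bounds top_ge u.
apply/andP; split; first by rewrite /lyapunov !addr_ge0// mulr_ge0 ?expR_ge0// ler0z.
rewrite /lyapunov /lyapunov_max [(_ + (max_collisions N top))%:~R]rmorphD/=.
rewrite [(_ + N%:Z * top)%:~R]rmorphD/= [X in _ <= X]mulrDr [X in _ <= X + _]mulrDr.
apply: lerD; last by apply: ler_wpM2l; rewrite ?expR_ge0 ?ler_int.
apply: lerD; last by apply: ler_wpM2l; rewrite ?expR_ge0 ?ler_int.
apply: ler_pM; rewrite ?expR_ge0 ?ler0z ?ler_int// ler_expR lerN2 ler_wpM2l//.
by rewrite rmorphD/=; have := top_gt; lra.
Qed.

(** Off the ladder one of the three potentials is in the situation where it
    decreases, which contributes [- 1].  The positive parts of the drifts are of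
    order [expR (- beta)]: for [capped] because [alpha <= top], for [debt]
    because [N - 2 <= alpha - 1], and for [collisions], whose maximum grows
    linearly with [alpha], because [alpha * expR (- (beta * (alpha - 1)))] stays
    bounded for [1 <= beta]. *)
Lemma lyapunov_drift u : 1 <= beta -> 2 <= alpha ->
  G lyapunov u <= drift_constant R N * expR (- beta) - \1_(~` ladder alpha) u.
Proof.
move=> bge1 a2; rewrite /lyapunov jump_generator_comb.
set e1 := expR (- (beta * (top + 1)%:~R)); set e2 := expR (- (beta * alpha)).
pose J : R := #|event N|%:R.
have J0 : 0 <= J by exact: ler0n.
have N0 : 0 <= N%:R :> R by exact: ler0n.
have e10 : 0 <= e1 by exact: expR_ge0.
have e20 : 0 <= e2 by exact: expR_ge0.
have tg := top_gt; have tl := top_le.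
have b1 : e1 * (J * (expR (beta * alpha) * N%:R)) <= J * (N%:R * expR (- beta)).
  rewrite mulrCA ler_wpM2l// mulrA mulrC ler_wpM2l// -expRD ler_expR.
  rewrite rmorphD/=; nra.
have b2 : e2 * (J * (expR (beta * (N%:R - 2)) * N%:R)) <= J * (N%:R * expR (- beta)).
  rewrite mulrCA ler_wpM2l// mulrA mulrC ler_wpM2l// -expRD ler_expR.
  have : 0 <= beta * (alpha - (N%:R - 1)) by rewrite mulr_ge0// subr_ge0 ltW.
  by lra.
have b3 : e2 * (J * (max_collisions N top)%:~R) <=
    J * (2 * N%:R ^+ 2 * expR (- beta)).
  rewrite mulrCA ler_wpM2l//.
  have -> : (max_collisions N top)%:~R = N%:R ^+ 2 * (1 + top%:~R) :> R.
    by rewrite /max_collisions !rmorphM/= (rmorphD _ 1 top)/= expr2.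
  have : e2 * (1 + top%:~R) <= 2 * expR (- beta).
    have -> : e2 = expR (- beta) * expR (- (beta * (alpha - 1))).
      by rewrite -expRD; congr expR; lra.
    rewrite mulrAC -mulrA mulrC ler_wpM2r ?expR_ge0// expRN.
    rewrite ler_pdivrMr ?expR_gt0//.
    have E1 := expR_ge1Dx (beta * (alpha - 1)).
    have : 0 <= (beta - 1) * (alpha - 1) by rewrite mulr_ge0// subr_ge0; lra.
    by lra.
  move=> le2; have := ler_wpM2l (sqr_ge0 (N%:R : R)) le2; lra.
have {b1 b2 b3} : e1 * (J * (expR (beta * alpha) * N%:R)) +
    e2 * (J * (expR (beta * (N%:R - 2)) * N%:R)) +
    e2 * (J * (max_collisions N top)%:~R) <=
    drift_constant R N * expR (- beta) by rewrite /drift_constant -/J; lra.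
have {J0} dC := capped_drift u; have dD := debt_drift u.
have dK := collisions_drift u.
rewrite -/J -[N%:Z%:~R]/(N%:R) in dC dD dK.
have lC := ler_wpM2l e10 dC; have lD := ler_wpM2l e20 dD.
have lK := ler_wpM2l e20 dK.
have e1V : e1 * expR (beta * (top + 1)%:~R) = 1 by rewrite -expRD addNr expR0.
have e2V : e2 * expR (beta * alpha) = 1 by rewrite -expRD addNr expR0.
rewrite indicE; have [uL|uL] := pselect (ladder alpha u).
  by rewrite memNset ?subr0; [lra | exact].
rewrite mem_set// mulr1n.
have [u0|u0] := boolP (nonneg u); last first.
  have {u0} /forallPn[a ua] := u0; rewrite -ltNge in ua.
  have := ler_wpM2l e20 (debt_drift_drop ua).
  by rewrite -/J -[N%:Z%:~R]/(N%:R) mulrBr e2V; lra.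
have [[a [b [ab uab]]]|inj] := pselect (exists a b, a != b /\ u a = u b).
  have := ler_wpM2l e20 (collisions_drift_drop u0 ab uab).
  by rewrite -/J mulrBr e2V; lra.
have [[a ua]|utop] := pselect (exists a, top < u a).
  have := ler_wpM2l e10 (capped_drift_drop ua).
  by rewrite -/J -[N%:Z%:~R]/(N%:R) mulrBr e1V; lra.
exfalso; apply: uL; split=> [a b ab|a].
  by apply/eqP => uab; apply: inj; exists a, b.
have /forallP -> /= := u0; rewrite leNgt; apply/negP => ua.
by apply: utop; exists a.
Qed.

End Drift.

(** * The ladder at low temperature *)

Section Ladder.
Context {R : realType} {N : nat}.
Variables alpha beta : R.
Hypothesis N_ge3 : (3 <= N)%N.
Hypothesis alpha_gt : N%:R - 1 < alpha.
Hypothesis beta_ge1 : 1 <= beta.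

Let beta_ge0 : 0 <= beta. Proof. exact: le_trans beta_ge1. Qed.

Let alpha_ge2 : 2 <= alpha.
Proof.
have : 3%:R <= N%:R :> R by rewrite ler_nat.
by have := alpha_gt; lra.
Qed.

Context {d : measure_display} {Omega : measurableType d}.
Variables (P : probability Omega R) (U : state N -> R -> Omega -> state N).
Hypothesis jumpU : markov_jump_process P U (generator beta alpha).

Let jumpU' :
  markov_jump_process P U (jump_generator (event_rate alpha beta) event_jump).
Proof. by rewrite -generatorE. Qed.

Let discrete (A : set (state N)) : measurable A. Proof. by []. Qed.

Let spread_ge0 (v : state N) : 0 <= (spread v)%:~R :> R.
Proof. by rewrite ler0z; apply: sumr_ge0 => a _; exact: normr_ge0. Qed.

Let spread_drift' := spread_drift beta_ge0 alpha_gt.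

Let lyapunov_bounds' := lyapunov_bounds beta_ge0 alpha_gt.

Let lyapunov_drift' (u : state N) :=
  lyapunov_drift beta_ge0 alpha_gt u beta_ge1 alpha_ge2.

Lemma ladder_mass (nu : probability (state N) R) : invariant_measure P U nu ->
  ((1 - drift_constant R N * expR (- beta))%:E <= nu (ladder alpha))%E.
Proof.
exact: (invariant_mass_ge discrete (@event_rate_ge0 _ _ _ _) jumpU' spread_ge0
  (@spread_finite _ _) spread_drift' lyapunov_bounds' lyapunov_drift').
Qed.

Lemma ladder_hitting_tail (u : state N) (t : R) : 0 < t ->
  (P [set w | (t%:E < hitting_time U u (ladder alpha) w)%E] <=
   (expR (- (beta * alpha)) * lyapunov_max N alpha / t +
    drift_constant R N * expR (- beta))%:E)%E.
Proof.
move=> t0; apply: le_trans (hitting_time_tail discrete (@event_rate_ge0 _ _ _ _)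
  jumpU' spread_ge0 (@spread_finite _ _) spread_drift' lyapunov_bounds'
  lyapunov_drift' u t0) _.
rewrite lee_fin lerD2r ler_wpM2r ?invr_ge0 ?(ltW t0)//.
by have /andP[] := lyapunov_bounds' u.
Qed.

End Ladder.

Lemma cvg_expRNM (R : realType) (c a : R) : 0 < a ->
  c * expR (- (beta * a)) @[beta --> +oo] --> 0.
Proof.
move=> a0; rewrite -[X in _ --> X](mulr0 c); apply: cvgM; first exact: cvg_cst.
apply: (@cvg_comp _ _ _ (fun beta : R => beta * a) (fun x => expR (- x)) _ +oo).
  exact: gt0_cvgMly.
exact: cvgr_expR.
Qed.

Theorem theorem4 (R : realType) (N : nat) (hN : (3 <= N)%N) :
  (exists C : R, 0 < C /\
    forall (alpha beta : R) (d : measure_display) (Omega : measurableType d)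
      (P : probability Omega R) (U : state N -> R -> Omega -> state N)
      (nu : probability (state N) R),
    N%:R - 1 < alpha -> 0 <= beta ->
    markov_jump_process P U (generator beta alpha) ->
    invariant_measure P U nu ->
    ((1 - C * expR (- beta))%:E <= nu (ladder alpha))%E) /\
  (forall (alpha : R) (d : measure_display) (Omega : measurableType d)
      (P : probability Omega R) (U : R -> state N -> R -> Omega -> state N),
    N%:R - 1 < alpha ->
    (forall beta : R, 0 <= beta ->
      markov_jump_process P (U beta) (generator beta alpha)) ->
    forall delta : R, 0 < delta ->
    ereal_sup [set P [set w |
        ((expR (- (beta * alpha * (1 - delta))))%:E <
         hitting_time (U beta) u (ladder alpha) w)%E] | u in [set: state N]]
      @[beta --> +oo] --> 0%E).
Proof.
have c0 : 0 <= drift_constant R N.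
  by rewrite mulr_ge0// addr_ge0// mulr_ge0// exprn_ge0.
split.
  exists (drift_constant R N + expR 1); split; first by rewrite ltr_wpDl// expR_gt0.
  move=> alpha beta d Omega P U nu alpha_gt beta_ge0 jumpU inv.
  have [beta1|beta1] := ltP beta 1.
    apply: le_trans (measure_ge0 _ _); rewrite lee_fin subr_le0.
    apply: (@le_trans _ _ (expR 1 * expR (- beta))).
      by rewrite -expRD; apply: le_trans (expR_ge1Dx _); lra.
    by rewrite ler_wpM2r ?expR_ge0// lerDr.
  apply: le_trans (ladder_mass hN alpha_gt beta1 jumpU inv).
  by rewrite lee_fin lerD2l lerN2 ler_wpM2r ?expR_ge0// lerDl expR_ge0.
move=> alpha d Omega P U alpha_gt jumpU delta delta_gt0.
have alpha_gt0 : 0 < alpha.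
  have : 3%:R <= N%:R :> R by rewrite ler_nat.
  by lra.
pose b (beta : R) := lyapunov_max N alpha * expR (- (beta * (alpha * delta))) +
  drift_constant R N * expR (- (beta * 1)).
apply: (@squeeze_cvge _ _ _ _ (cst 0%E) _ (EFin \o b)).
- near=> beta; have beta1 : 1 <= beta by near: beta; exact: nbhs_pinfty_ge.
  have beta0 : 0 <= beta by exact: le_trans beta1.
  apply/andP; split.
    apply: le_trans (measure_ge0 P _) (ereal_sup_ubound _).
    by exists (point : state N).
  apply: ge_ereal_sup => _ [u _ <-].
  apply: le_trans
    (ladder_hitting_tail hN alpha_gt beta1 (jumpU _ beta0) u (expR_gt0 _)) _.
  rewrite lee_fin /b mulr1 lerD2r mulrAC -expRN -expRD mulrC.
  by rewrite le_eqVlt; apply/orP; left; apply/eqP; congr (_ * expR _); lra.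
- exact: cvg_cst.
- apply: cvg_EFin; first exact: nearW.
  rewrite -[X in _ --> X](addr0 0).
  by apply: cvgD; apply: cvg_expRNM => //; exact: mulr_gt0.
Unshelve. all: by end_near. Qed.
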